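(* Let $m, k, s_1, s_2, t$ be positive integers such that $m$ is even, $s_1 > s_2$ and $s_1 + 3 s_2 > k$. Then $$g(n,m) \geq n + (k + s_1 + 2 s_2 + 1)t - 1$$ for every integer $n$ satisfying $$n \geq \Big(\tfrac{3}{4}mk^{2}+\tfrac{1}{2}mks_{1}+\tfrac{3}{2}mks_{2}+\tfrac{1}{2}ms_{1}^{2}+\tfrac{3}{2}ms_{1}s_{2}+\tfrac{9}{4}ms_{2}^{2}+mk+ms_{1}+3ms_{2}+\tfrac{1}{2}m\Big)t^{2} + \Big(\tfrac{1}{4}mk+\tfrac{1}{2}ms_{1}+\tfrac{3}{4}ms_{2}-k-s_{1}-2s_{2}+\tfrac{1}{2}m-1\Big)t+1.$$
   Context: Graphs are finite and undirected; loops and multiple edges are allowed, a loop being a cycle of length $1$ and a pair of parallel edges forming a cycle of length $2$. For a graph $G$ with $n$ vertices, let $c_i$ be the number of cycles of length $i$ in $G$ ($1 \le i \le n$). For nonnegative integers $a_1, \dots, a_n$, let $f(a_1, a_2, \dots, a_n)$ denote the maximum possible number of edges in a graph with $n$ vertices satisfying $c_i \leq a_i$ for all $1\le i\le n$. For positive integers $n, m$, define $g(n,m) = f(a_1, \dots, a_n)$ where $a_i = 1$ if $i/m$ is an integer and $a_i = 0$ otherwise. That is, $g(n,m)$ is the maximum number of edges in an $n$-vertex graph in which every cycle has length divisible by $m$ and no two distinct cycles have the same length. *)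

(* Defs.v *)
From mathcomp Require Import all_boot.
From mathcomp Require Import boolp.

Set Implicit Arguments.
Unset Strict Implicit.
Unset Printing Implicit Defensive.

(* Finite undirected multigraphs. [ends e] is the unordered set of endpoints
   of [e]: one element for a loop, two otherwise; [ends] need not be injective,
   so parallel edges are allowed. *)
Record mgraph := MGraph {
  vertex : finType;
  edge : finType;
  ends : edge -> {set vertex};
  ends_card : forall e, 0 < #|ends e| <= 2
}.

(* A cycle v_0 e_0 v_1 e_1 ... v_(i-1) e_(i-1) v_0 with distinct vertices and
   distinct edges is a subgraph determined by its edge set C, so rotations and
   reversals of the sequence give the same cycle.  [ordS] is the cyclic
   successor on 'I_i, so i = 1 gives loops and i = 2 pairs of parallel edges. *)
Definition is_cycle (G : mgraph) (i : nat) (C : {set edge G}) : bool :=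
  [exists v : {ffun 'I_i -> vertex G}, exists e : {ffun 'I_i -> edge G},
    [&& injectiveb v, injectiveb e,
        [forall j, ends (e j) == [set v j; v (ordS j)]]
      & C == [set e j | j : 'I_i]]].

Definition ncycles (G : mgraph) (i : nat) : nat :=
  #|[set C : {set edge G} | is_cycle i C]|.

Definition admissible (n : nat) (a : nat -> nat) (M : nat) : Prop :=
  exists G : mgraph,
    [/\ #|vertex G| = n, #|edge G| = M
      & forall i, 0 < i <= n -> ncycles G i <= a i].

Lemma admissible0 n a : exists M, `[< admissible n a M >].
Proof.
exists 0; apply/asboolP.
have H (e : void) : 0 < #|(fun _ : void => set0 : {set 'I_n}) e| <= 2 by case: e.
exists (MGraph H); split; rewrite ?card_ord ?card_void // => -[|i] // _.
rewrite /ncycles eq_card0 // => C; rewrite !inE; apply/negbTE/negP.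
by case/existsP=> v /existsP[e _]; case: (e ord0).
Qed.

Lemma loop_cycle (G : mgraph) (x : vertex G) (e : edge G) :
  ends e = [set x] -> is_cycle 1 [set e].
Proof.
move=> ex; apply/existsP; exists [ffun=> x]; apply/existsP; exists [ffun=> e].
apply/and4P; split; try by apply/injectiveP=> j k _; rewrite !ord1.
  by apply/forallP=> j; rewrite !ffunE ex setUid.
apply/eqP/setP=> y; rewrite inE; apply/eqP/imsetP=> [->|[j _ ->]].
  by exists ord0; rewrite ?ffunE.
by rewrite ffunE.
Qed.

Lemma parallel_cycle (G : mgraph) (x y : vertex G) (e f : edge G) :
  x != y -> e != f -> ends e = [set x; y] -> ends f = [set x; y] ->
  is_cycle 2 [set e; f].
Proof.
move=> xy ef ex fx; apply/existsP.
exists [ffun j : 'I_2 => if j == ord0 then x else y]; apply/existsP.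
exists [ffun j : 'I_2 => if j == ord0 then e else f].
have inj2 (T : eqType) (u v : T) : u != v ->
    injective (fun j : 'I_2 => if j == ord0 then u else v).
  move=> uv [[|[|//]] Hj] [[|[|//]] Hk] //= E; apply/val_inj => //=.
    by rewrite E eqxx in uv.
  by rewrite E eqxx in uv.
apply/and4P; split.
- by apply/injectiveP=> j k; rewrite !ffunE => /inj2; apply.
- by apply/injectiveP=> j k; rewrite !ffunE => /inj2; apply.
- apply/forallP=> -[[|[|//]] Hj]; rewrite !ffunE /=; first by rewrite ex.
  by rewrite fx setUC.
- apply/eqP/setP=> z; rewrite !inE; apply/orP/imsetP=> [[/eqP->|/eqP->]|[j _ ->]].
  + by exists ord0; rewrite ?ffunE.
  + by exists (lift ord0 ord0); rewrite ?ffunE.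
  + by rewrite ffunE; case: (j == ord0); rewrite eqxx; [left|right].
Qed.

Lemma admissible_bound n a M :
  `[< admissible n a M >] -> M <= 2 ^ n * (a 1 + a 2).+1.
Proof.
move=> /asboolP[G [cV <- cyc]].
pose F (S : {set vertex G}) := [set e : edge G | ends e == S].
suff HF S : #|F S| <= (a 1 + a 2).+1.
  have -> : #|edge G| = \sum_(S : {set vertex G}) #|F S|.
    rewrite -sum1_card (partition_big (@ends G) xpredT) //=.
    by apply: eq_bigr => S _; rewrite sum1dep_card; apply: eq_card => e.
  apply: (@leq_trans (\sum_(S : {set vertex G}) (a 1 + a 2).+1)).
    exact: leq_sum.
  by rewrite sum_nat_const -cardsT -powersetT card_powerset cardsT cV.
have [->|[e0 e0S]] := set_0Vmem (F S); first by rewrite cards0.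
have /eqP e0E : ends e0 == S by move: e0S; rewrite inE.
have := ends_card e0; rewrite e0E.
case cS: #|S| => [|[|[|c]]] // _.
- have /cards1P[x Sx] : #|S| == 1 by rewrite cS.
  have n1 : 0 < 1 <= n by rewrite /= -cV -cS max_card.
  apply: leq_trans (_ : a 1 <= _); last by rewrite -addnS leq_addr.
  apply: leq_trans (cyc _ n1).
  rewrite -(card_imset (F S) (@set1_inj _)); apply: subset_leq_card.
  apply/subsetP=> _ /imsetP[e eF ->]; move: eF; rewrite !inE => /eqP eS.
  by apply: (@loop_cycle _ x); rewrite eS.
- have /cards2P[x [y [xy Sxy]]] : #|S| == 2 by rewrite cS.
  have n2 : 0 < 2 <= n by rewrite /= -cV -cS max_card.
  rewrite (cardsD1 e0) e0S add1n ltnS.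
  apply: leq_trans (leq_addl _ _); apply: leq_trans (cyc _ n2).
  have inj : {in F S :\ e0 &, injective (fun e => [set e0; e])}.
    move=> e f; rewrite !inE => /andP[ne _] /andP[_ _] /setP/(_ e).
    by rewrite !inE eqxx (negbTE ne) /= => /esym/eqP.
  rewrite -(card_in_imset inj); apply: subset_leq_card.
  apply/subsetP=> _ /imsetP[e eF ->]; move: eF; rewrite !inE => /andP[ne /eqP eS].
  by apply: (parallel_cycle xy); rewrite ?e0E ?eS // eq_sym.
Qed.

Definition f (n : nat) (a : nat -> nat) : nat :=
  ex_maxn (admissible0 n a) (@admissible_bound n a).

Lemma fP n a :
  admissible n a (f n a) /\ forall M, admissible n a M -> M <= f n a.
Proof.
rewrite /f; case: ex_maxnP => M /asboolP aM maxM; split=> // N aN.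
by apply: maxM; apply/asboolP.
Qed.

Definition g (n m : nat) : nat := f n (fun i => if m %| i then 1 else 0).

(* Main.v *)
Require Import Defs.
From mathcomp Require Import all_boot all_order all_algebra.
From mathcomp Require Import zify lra.

(** The graph is a union of t(s1 + s2 + 1) fans glued at one vertex, the hub,
    together with pendant edges at the hub that bring the number of vertices to
    n.  A fan with q spokes is a path from the hub to the hub, the rim, with q
    interior branch points, each joined to the hub by a path, its spoke.  Its
    cycles correspond to the pairs i < j among its rim points
    0, 1, ..., q + 1, where 0 and q + 1 are the hub, and its cyclomatic number
    is q + 1.  A fan with q = 0 is a cycle, and one with q = 1 is a theta graph.

    Let X and T be given with q T <= X.  For a = 1, ..., T one can choose the
    lengths of the rim segments and of the spokes so that cycle (i, j) of the
    a-th fan has length m times X + ((j - i - 1)(q + 1) + i) T + a.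
    These values are distinct, since i <= q, and lie in the interval from X + 1
    to X + (q(q + 1) + 1) T.  Spokes have lengths that are multiples of m/2,
    which is where the evenness of m is used.  The families

      - q = 0, X = 0, T = s1 t (single cycles),
      - q = 1, X = s1 t, T = s2 t (theta graphs),
      - q = k, X = (s1 + 3 s2) t, T = t

    use consecutive intervals, and the hypotheses s2 < s1 and k < s1 + 3 s2 give
    q T <= X for the last two.  The total cyclomatic number is
    s1 t + 2 s2 t + (k + 1) t, so a connected graph of this kind on n vertices
    has n - 1 + (k + s1 + 2 s2 + 1) t edges.  The bound on n says
    exactly that the fans need at most n vertices ([fan_half_total],
    [admissible_of_families]).

    What remains is to know all the cycles.  Every cycle has degree 0 or 2 at
    each vertex ([cycle_two_regular]), and this alone is enough.  It forces the
    cycle to contain each subdivided edge entirely or not at all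
    ([piece_const]), and the spoke at a rim point exactly when one of the two
    rim segments there is used ([spoke_used]).  The edges used at the hub are
    thus the jumps of 0/1 sequences along the rims.  Every rim has an even number of
    jumps and the hub has degree at most 2, so exactly one rim is used, with two
    jumps i < j ([base_two_regular_arc]). *)

Set Implicit Arguments.
Unset Strict Implicit.
Unset Printing Implicit Defensive.

(** * Cycles of a loopless multigraph as 2-regular edge sets *)

Definition deg (G : mgraph) (C : {set edge G}) (w : vertex G) : nat :=
  \sum_(e in C) (w \in ends e).

(** Connectedness is deliberately left out: in the graphs built below, every
    nonempty edge set with all degrees 0 or 2 is a single cycle, because all
    of its components would have to meet at the hub, which has degree at
    most 2. *)
Definition two_regular (G : mgraph) (C : {set edge G}) :=
  C != set0 /\ forall w, exists b : bool, deg C w = b.*2.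

Definition loopless (G : mgraph) := forall e : edge G, #|ends e| = 2.

(** Turns incidence with a non-loop edge into a sum over its two ends, so that
    degrees can be computed additively along paths. *)
Lemma mem_pair (T : finType) (a b w : T) :
  a != b -> (w \in [set a; b]) = (a == w) + (b == w) :> nat.
Proof.
move=> ab; rewrite !inE !(eq_sym w).
by case: (eqVneq a w) => [<-|//]; rewrite eq_sym (negbTE ab).
Qed.

(** In a cycle v_0 e_0 v_1 e_1 ... each vertex is counted once as the start v_j
    and once as the end v_(j+1) of an edge.  The second count is the first one
    shifted by the cyclic successor, so every degree is twice the number of j
    with v_j = w, which is at most 1. *)
Lemma cycle_two_regular (G : mgraph) i (C : {set edge G}) :
  loopless G -> 0 < i -> is_cycle i C -> two_regular C /\ #|C| = i.
Proof.
move=> lG i0 /existsP[v /existsP[e]].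
move=> /and4P[/injectiveP vI /injectiveP eI /forallP eE /eqP CE].
have cC : #|C| = i by rewrite CE card_imset // card_ord.
split=> //; split=> [|w]; first by rewrite -card_gt0 cC.
have vS j : v j != v (ordS j).
  by have := lG (e j); rewrite (eqP (eE j)) cards2; case: (v j != v (ordS j)).
have degE : deg C w = (\sum_j (v j == w)).*2.
  rewrite /deg CE big_imset /=; last by move=> a b _ _; apply: eI.
  rewrite (eq_bigr (fun j => (v j == w) + (v (ordS j) == w))); last first.
    by move=> j _; rewrite (eqP (eE j)) mem_pair.
  rewrite big_split /= -addnn; congr (_ + _).
  by rewrite [RHS](reindex_inj (@ordS_inj i)).
have [/existsP[j /eqP jw]|/existsPn no] := boolP [exists j, v j == w].
  exists true; rewrite degE (bigD1 j) //= jw eqxx big1 // => l lj.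
  by rewrite -jw (inj_eq vI) (negbTE lj).
by exists false; rewrite degE big1 // => j _; rewrite (negbTE (no j)).
Qed.

(** Asking for both properties of all 2-regular edge sets, of which cycles are
    an instance, frees the rest of the proof from cyclic sequences of vertices
    and edges. *)
Lemma admissible_of_two_regular (G : mgraph) m :
  loopless G ->
  (forall C : {set edge G}, two_regular C -> m %| #|C|) ->
  (forall C D : {set edge G},
     two_regular C -> two_regular D -> #|C| = #|D| -> C = D) ->
  #|edge G| <= g #|vertex G| m.
Proof.
move=> lG dvd uni; apply: (fP _ _).2; exists G; split=> // i /andP[i0 _].
case: ifP => [_|mi].
  apply/card_le1_eqP => C D; rewrite !inE.
  move=> Cc Dc; have [C2 Ci] := cycle_two_regular lG i0 Cc.
  by have [D2 Di] := cycle_two_regular lG i0 Dc; apply: uni; rewrite ?Ci.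
rewrite leqn0 cards_eq0; apply/eqP/setP => C; rewrite !inE.
case Cc: (is_cycle i C) => //; have [/dvd] := cycle_two_regular lG i0 Cc.
by move=> /[swap] ->; rewrite mi.
Qed.

(** * Paths with new interior points *)

Lemma card_tagged_ord (B : finType) (F : B -> nat) :
  #|{: {b : B & 'I_(F b)}}| = \sum_b F b.
Proof.
rewrite card_tagged sumnE big_map big_enum.
by apply: eq_bigr => b _; rewrite card_ord.
Qed.

Section Paths.
Variables (U S : finType) (src tgt : S -> U) (len : S -> nat).
Hypothesis len_gt0 : forall s, 0 < len s.

(** Each s : S stands for a path with [len s] edges from [src s] to [tgt s];
    its [(len s).-1] interior points are new.  The same encoding serves to
    subdivide the edges of a multigraph and to lay out the rim of a fan, which
    is a path whose two ends are the hub. *)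
Definition sub_vertex := (U + {s : S & 'I_(len s).-1})%type.

Definition inner s (j : 'I_(len s).-1) : sub_vertex := inr (existT _ s j).

(** The i-th point of path s; positions from [len s] on denote its end. *)
Definition point (s : S) (i : nat) : sub_vertex :=
  if i is i'.+1 then if insub i' is Some j then @inner s j else inl (tgt s)
  else inl (src s).
Arguments point : simpl never.

Lemma point_inner s s' i (j : 'I_(len s).-1) : i <= len s' ->
  (point s' i == inner j) = (s' == s) && (i == j.+1).
Proof.
case: i => [|i] lti; rewrite /point /=; first by rewrite andbF.
case: insubP => [l il lE|il].
  rewrite -lE eqSS; case: (eqVneq s' s) => [E|ne].
    case: s / E j => j; apply/eqP/eqP => [[] /eqP|/val_inj -> //].
    by rewrite eq_Tagged /= => /eqP ->.
  by apply/eqP => -[E]; rewrite E eqxx in ne.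
apply/esym/negP => /andP[/eqP E /eqP iE]; case/negP: il.
by have := ltn_ord j; rewrite E; lia.
Qed.

Lemma point_ordS s (j : 'I_(len s).-1) : point s j.+1 = inner j.
Proof.
by apply/eqP; rewrite point_inner ?eqxx //; have := ltn_ord j; lia.
Qed.

Lemma point_end s i u :
  i <= len s -> (point s i == inl u) =
    ((i == 0) && (src s == u)) || ((i == len s) && (tgt s == u)).
Proof.
have l0 := len_gt0 s; case: i => [|i] lti.
  by rewrite (ltn_eqF l0) orbF.
rewrite /point; case: insubP => [j lt _|]; last first.
  by rewrite -leqNgt => ?; have -> : i.+1 == len s by lia.
by have -> : (i.+1 == len s) = false by lia.
Qed.

Lemma point_neq s i : (src s != tgt s) || (1 < len s) -> i < len s ->
  point s i != point s i.+1.
Proof.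
move=> proper lti; have [lt1|ge1] := ltnP i (len s).-1.
  rewrite (point_ordS (Ordinal lt1)) point_inner; last exact: ltnW.
  by rewrite (ltn_eqF (ltnSn i)) andbF.
have -> : i.+1 = len s by lia.
have -> : point s (len s) = inl (tgt s).
  by apply/eqP; rewrite point_end ?eqxx ?orbT.
rewrite point_end; last exact: ltnW.
rewrite (ltn_eqF lti) orbF negb_and; case: eqP => //= i0.
by case/orP: proper => // l1; lia.
Qed.

(** An interior point of a path meets exactly the two consecutive path edges
    around it, and no edge of another path. *)
Lemma sum_point_inner (F : forall s, 'I_(len s) -> nat) s (j : 'I_(len s).-1)
    (lj : j < len s) (ljS : j.+1 < len s) :
  \sum_s' \sum_(i < len s')
     F s' i * ((point s' i == inner j) + (point s' i.+1 == inner j)) =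
  F s (Ordinal lj) + F s (Ordinal ljS).
Proof.
rewrite (bigD1 s) //= [X in _ + X]big1 ?addn0; last first.
  move=> s' ne; rewrite big1 // => l _.
  by rewrite (point_inner _ (ltnW (ltn_ord l))) point_inner // (negbTE ne) muln0.
rewrite (bigD1 (Ordinal lj)) //= (bigD1 (Ordinal ljS)) /=; last first.
  by rewrite -val_eqE /=; lia.
rewrite big1; last first.
  move=> l /andP[]; rewrite -!val_eqE /= => n1 n2.
  rewrite (point_inner _ (ltnW (ltn_ord l))) point_inner // eqSS.
  by rewrite (negbTE n1) (negbTE n2) !andbF muln0.
rewrite !point_inner ?(ltnW lj) ?(ltnW ljS) // !eqxx /=.
by rewrite ltn_eqF // eqn_leq ltnn !muln1 addn0.
Qed.

(** A vertex outside the interiors meets a path only through its first and its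
    last edge.  Both terms count when the path is closed at u. *)
Lemma sum_point_end s (F : 'I_(len s) -> nat) u (ll : (len s).-1 < len s) :
  \sum_(i < len s) F i * ((point s i == inl u) + (point s i.+1 == inl u)) =
  F (Ordinal (len_gt0 s)) * (src s == u) + F (Ordinal ll) * (tgt s == u).
Proof.
under eq_bigr do rewrite mulnDr.
rewrite big_split /=; congr (_ + _).
  rewrite (bigD1 (Ordinal (len_gt0 s))) //= big1 ?addn0 // => i.
  rewrite -val_eqE /= => ne; rewrite point_end; last exact: ltnW.
  by rewrite (negbTE ne) (ltn_eqF (ltn_ord i)) muln0.
rewrite (bigD1 (Ordinal ll)) //= big1 ?addn0 => [|i].
  by rewrite prednK // point_end // eqxx eqn0Ngt len_gt0.
rewrite -val_eqE /= => ne; rewrite point_end //=.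
have -> : (i.+1 == len s) = false by have := ltn_ord i; lia.
by rewrite muln0.
Qed.

End Paths.

Arguments point {U S} src tgt {len} s i : simpl never.
Arguments inner U {S len s} j.

(** * Subdivision of a weighted multigraph *)

Section Subdivision.
Variables (U S : finType) (src tgt : S -> U) (len : S -> nat).
Hypothesis len_gt0 : forall s, 0 < len s.
Hypothesis proper : forall s, (src s != tgt s) || (1 < len s).

Definition sub_edge := {s : S & 'I_(len s)}.

Definition sub_ends (e : sub_edge) : {set sub_vertex U len} :=
  [set point src tgt (tag e) (tagged e); point src tgt (tag e) (tagged e).+1].

Lemma sub_ends_card e : #|sub_ends e| = 2.
Proof. by rewrite cards2 point_neq // ltn_ord. Qed.

Lemma sub_ends_le2 e : 0 < #|sub_ends e| <= 2.
Proof. by rewrite sub_ends_card. Qed.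

Definition subdivision : mgraph := MGraph sub_ends_le2.

Lemma card_sub_edge : #|{: sub_edge}| = \sum_s len s.
Proof. exact: card_tagged_ord. Qed.

Lemma card_sub_vertex : #|{: sub_vertex U len}| + #|S| = #|U| + \sum_s len s.
Proof.
rewrite card_sum card_tagged_ord -addnA; congr (_ + _).
rewrite -sum1_card -big_split; apply: eq_bigr => s _ /=.
by rewrite addn1 prednK.
Qed.

Definition piece s (i : 'I_(len s)) : edge subdivision := existT _ s i.

(** A 2-regular set contains a whole path or none of it, so its trace on the
    base multigraph can be read off on the first edge of each path. *)
Definition uses (C : {set edge subdivision}) (s : S) : bool :=
  piece (Ordinal (len_gt0 s)) \in C.

Lemma deg_subE (C : {set edge subdivision}) (w : vertex subdivision) :
  deg C w = \sum_s \sum_(i < len s) (piece i \in C) *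
     ((point src tgt s i == w) + (point src tgt s i.+1 == w)).
Proof.
rewrite /deg sig_big_dep /= big_mkcond /=; apply: eq_bigr => -[s i] _ /=.
rewrite /piece; case: ifP => // inC.
by rewrite mul1n mem_pair // point_neq.
Qed.

(** Propagation along the path: the interior point between two consecutive
    edges has degree 0 or 2, so both edges belong to C or neither does. *)
Lemma piece_const (C : {set edge subdivision}) s (i : 'I_(len s)) :
  two_regular C -> (piece i \in C) = uses C s.
Proof.
move=> [_ Cdeg]; case: i => i; elim: i => [|i IH] lti.
  by rewrite /uses (bool_irrelevance lti (len_gt0 s)).
have lti0 : i < len s by exact: ltnW.
have lti' : i < (len s).-1 by lia.
rewrite -(IH lti0).
have [b] := Cdeg (inner U (Ordinal lti')).
rewrite deg_subE (@sum_point_inner _ _ _ _ _ (fun s i => piece i \in C) s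
  (Ordinal lti') lti0 lti).
by case: (_ \in C); case: (_ \in C); case: b.
Qed.

Lemma uses_inj (C D : {set edge subdivision}) :
  two_regular C -> two_regular D -> uses C =1 uses D -> C = D.
Proof.
move=> rC rD CD; apply/setP => -[s i].
by rewrite -!/(piece i) !piece_const.
Qed.

Lemma card_uses (C : {set edge subdivision}) : two_regular C ->
  #|C| = \sum_s uses C s * len s.
Proof.
move=> rC; transitivity (\sum_s \sum_(i < len s) (piece i \in C : nat)).
  rewrite sig_big_dep /= -sum1_card big_mkcond; apply: eq_bigr => -[s i] _ /=.
  by rewrite /piece; case: ifP.
apply: eq_bigr => s _; under eq_bigr => i _ do rewrite piece_const //.
by rewrite sum_nat_const card_ord mulnC.
Qed.

Lemma deg_base (C : {set edge subdivision}) (u : U) : two_regular C ->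
  deg C (inl u : vertex subdivision) =
    \sum_s uses C s * ((src s == u) + (tgt s == u)).
Proof.
move=> rC; rewrite deg_subE; apply: eq_bigr => s _.
have ll : (len s).-1 < len s by rewrite prednK.
rewrite (@sum_point_end _ _ _ _ _ len_gt0 s (fun i => piece i \in C) _ ll).
by rewrite !piece_const // mulnDr.
Qed.

End Subdivision.

Section Weighted.
Variables (U S : finType) (src tgt : S -> U).

(** A loop of the base counts twice at its vertex, as it should once it has
    been subdivided. *)
Definition base_two_regular (X : S -> bool) :=
  (exists s, X s) /\
  forall u, exists b : bool, \sum_s X s * ((src s == u) + (tgt s == u)) = b.*2.

(** Reduction to the base: edge lengths become weights, and the number of
    vertices of the subdivision is determined by the Euler characteristic. *)
Lemma admissible_of_weights (len : S -> nat) m :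
  (forall s, 0 < len s) ->
  (forall s, (src s != tgt s) || (1 < len s)) ->
  (forall X, base_two_regular X -> m %| \sum_s X s * len s) ->
  (forall X Y, base_two_regular X -> base_two_regular Y ->
     \sum_s X s * len s = \sum_s Y s * len s -> X =1 Y) ->
  \sum_s len s <= g (#|U| + \sum_s len s - #|S|) m.
Proof.
move=> len_gt0 proper dvd uni.
have reg (C : {set edge (subdivision len_gt0 proper)}) :
    two_regular C -> base_two_regular (uses C).
  move=> rC; split=> [|u].
    have [/set0Pn[[s i] siC] _] := rC; exists s.
    by rewrite -(piece_const i rC).
  by case: (rC) => _ /(_ (inl u))[b]; rewrite (deg_base _ rC) => ?; exists b.
rewrite -(card_sub_vertex U len_gt0) addnK -card_sub_edge.
apply: (@admissible_of_two_regular (subdivision len_gt0 proper)).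
- by move=> e; apply: sub_ends_card.
- by move=> C rC; rewrite (card_uses rC); apply/dvd/reg.
move=> C D rC rD; rewrite !card_uses // => E.
by apply: (uses_inj rC rD); apply: uni E; apply: reg.
Qed.

End Weighted.

(** * Boolean sequences with two jumps *)

Definition jumps (x : nat -> bool) N := \sum_(l < N) (x l (+) x l.+1).

(** Each jump flips the value, so parity compares the two extremes. *)
Lemma odd_jumps x N : odd (jumps x N) = x 0 (+) x N.
Proof.
rewrite /jumps; elim: N => [|N IH]; first by rewrite big_ord0 addbb.
by rewrite big_ord_recr oddD IH /= oddb addbA addbK.
Qed.

Lemma jumps0 x N l : x 0 = false -> jumps x N = 0 -> l <= N -> x l = false.
Proof.
move=> x0 /eqP; rewrite sum_nat_eq0 => /forallP j0.
elim: l => [//|l IH lN]; have := j0 (Ordinal lN).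
by rewrite /= IH ?(ltnW lN) //; case: (x l.+1).
Qed.

(** A sequence that starts at 0 and jumps twice is the indicator function of an
    interval, shifted by one: position [l.+1] of the sequence will hold rim
    segment l. *)
Lemma jumps2 x N : x 0 = false -> jumps x N = 2 ->
  exists i j, i < j < N /\ forall l, l < N ->
    x l.+1 = (i <= l < j) /\ x l (+) x l.+1 = (l == i) || (l == j).
Proof.
move=> x0 jx; pose z l := x l (+) x l.+1.
have [i [j [ij zE]]] : exists i j, i < j < N /\
    forall l, l < N -> z l = (l == i) || (l == j).
  have /cards2P[a [b [ab AE]]] : #|[set l : 'I_N | z l]| == 2.
    rewrite -jx /jumps -sum1dep_card big_mkcond /=; apply/eqP/eq_bigr => l _.
    by rewrite /z; case: ifP.
  have zA l (lN : l < N) : z l = (l == a) || (l == b).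
    by have := in_set2 (Ordinal lN) a b; rewrite -AE inE -!val_eqE.
  move: ab; rewrite -val_eqE neq_ltn => /orP[ab|ba].
    by exists a, b; split; rewrite ?ab ?ltn_ord.
  by exists b, a; split=> [|l lN]; rewrite ?ba ?ltn_ord // zA // orbC.
exists i, j; split=> // l lN; split; last exact: zE.
elim: l lN => [|l IH] lN; first by have := zE _ lN; rewrite /z x0 /=; lia.
have := zE _ lN; rewrite /z IH ?(ltnW lN) //; lia.
Qed.

(** * Fans glued at a common hub *)

Section Fans.
(** The base multigraph: p pendant edges at the hub and, for each b : B, a fan
    with [c b] spokes.  The rim of a fan is a path with [(c b).+1] segments from
    the hub to the hub, and a spoke joins each of its [c b] interior points to
    the hub.  The pendant edges lie on no cycle; they adjust the number of
    vertices. *)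
Variables (B : finType) (c : B -> nat) (p : nat).

Definition fan_vertex := sub_vertex (option 'I_p) (fun b => (c b).+1).
Definition fan_edge := ('I_p + ({b : B & 'I_(c b).+1} + {b : B & 'I_(c b)}))%type.

Definition hub : fan_vertex := inl None.
Definition leaf q : fan_vertex := inl (Some q).
Definition node b l : fan_vertex := point (fun=> None) (fun=> None) b l.
Arguments node : simpl never.

Definition fan_src (e : fan_edge) : fan_vertex :=
  if e is inr (inl r) then node (tag r) (tagged r) else hub.

Definition fan_tgt (e : fan_edge) : fan_vertex :=
  match e with
  | inl q => leaf q
  | inr (inl r) => node (tag r) (tagged r).+1
  | inr (inr o) => node (tag o) (tagged o).+1
  end.

Definition rim_edge b (l : 'I_(c b).+1) : fan_edge := inr (inl (existT _ b l)).
Definition spoke_edge b (o : 'I_(c b)) : fan_edge := inr (inr (existT _ b o)).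

Lemma sum_fan_edge (F : fan_edge -> nat) :
  \sum_e F e = \sum_q F (inl q) + (\sum_b \sum_l F (@rim_edge b l) +
     \sum_b \sum_o F (@spoke_edge b o)).
Proof.
rewrite !big_sumType /= !sig_big_dep /=; congr (_ + (_ + _)).
  by apply: eq_bigr => -[].
by apply: eq_bigr => -[].
Qed.

(** The cycle that leaves the hub for rim point i, follows the rim up to rim
    point j and returns to the hub.  Rim points 0 and [(c b).+1] are the hub
    itself, hence no spoke is used there; spoke [o : 'I_(c b)] sits at rim
    point [o.+1]. *)
Definition arc b i j (e : fan_edge) : bool :=
  match e with
  | inl _ => false
  | inr (inl r) => (tag r == b) && (i <= tagged r < j)
  | inr (inr o) => (tag o == b) && (((tagged o).+1 == i) || ((tagged o).+1 == j))
  end.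

Section Classification.
Variable X : fan_edge -> bool.
Hypothesis regX : base_two_regular fan_src fan_tgt X.

(** Membership of the rim segments, shifted by one and padded with [false] on
    both sides.  With this padding the jumps of the sequence are exactly the
    edges of X at the hub: the spokes, the first and the last rim segment. *)
Definition along b l : bool :=
  if l is l'.+1 then if insub l' is Some o then X (@rim_edge b o) else false
  else false.

Arguments along : simpl never.

Lemma alongE b (l : 'I_(c b).+1) : along b l.+1 = X (rim_edge l).
Proof. by rewrite /along valK. Qed.

Lemma along_end b : along b (c b).+2 = false.
Proof. by rewrite /along insubF ?ltnn. Qed.

(** A leaf has degree at most 1, hence 0. *)
Lemma leaf_unused q : X (inl q) = false.
Proof.
have node_leaf b l : (node b l == leaf q) = false.
  by rewrite /node /point; case: l => [//|l]; case: insubP.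
have [_ /(_ (leaf q))[b]] := regX.
rewrite sum_fan_edge (bigD1 q) //= big1 => [|q' ne]; last first.
  have -> : (leaf q' == leaf q) = false; last by rewrite muln0.
  by apply/eqP => -[E]; rewrite E eqxx in ne.
rewrite big1 => [|b' _]; last by rewrite big1 // => l _; rewrite !node_leaf /= muln0.
rewrite big1 => [|b' _]; last by rewrite big1 // => l _; rewrite node_leaf /= muln0.
by rewrite eqxx; case: (X _); case: b.
Qed.

(** The degree of a rim point is even, so its spoke is used exactly when one of
    the two rim segments around it is. *)
Lemma spoke_used b (o : 'I_(c b)) :
  X (spoke_edge o) = along b o.+1 (+) along b o.+2.
Proof.
have [_ /(_ (inner _ (o : 'I_((c b).+1).-1)))[d]] := regX.
have lo : o < (c b).+1 by rewrite ltnS ltnW.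
have loS : o.+1 < (c b).+1 by rewrite ltnS.
rewrite sum_fan_edge big1 ?add0n => [|q _]; last by rewrite muln0.
rewrite (@sum_point_inner _ _ _ _ _ (fun b l => X (@rim_edge b l)) _ _ lo loS).
have tgtE b' (o' : 'I_(c b')) :
    (node b' o'.+1 == inner _ (o : 'I_((c b).+1).-1)) =
    (b' == b) && (o' == o :> nat).
  by rewrite /node point_inner // ltnS ltnW.
rewrite (bigD1 b) //= [X in _ + (_ + X)]big1 ?addn0 => [|b' ne]; last first.
  by rewrite big1 // => o' _; rewrite tgtE (negbTE ne) muln0.
rewrite (bigD1 o) //= [X in _ + (_ + X)]big1 ?addn0 => [|o' ne]; last first.
  by rewrite tgtE (inj_eq val_inj) (negbTE ne) andbF muln0.
have -> : along b o.+1 = X (rim_edge (Ordinal lo)) := alongE (Ordinal lo).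
have -> : along b o.+2 = X (rim_edge (Ordinal loS)) := alongE (Ordinal loS).
rewrite tgtE !eqxx /=.
by case: (X _); case: (X _); case: (X _); case: d.
Qed.

Lemma hub_jumps : exists d : bool, \sum_b jumps (along b) (c b).+2 = d.*2.
Proof.
have [_ /(_ hub)[d]] := regX.
rewrite sum_fan_edge big1 ?add0n => [|q _]; last by rewrite leaf_unused.
rewrite -big_split /= => Hd; exists d; rewrite -{}Hd; apply: eq_bigr => b _.
have lc : (c b).+1.-1 < (c b).+1 by [].
rewrite (@sum_point_end _ _ _ _ _ (fun b => ltn0Sn (c b)) b
  (fun l => X (rim_edge l)) _ lc).
have -> : X (rim_edge (Ordinal (ltn0Sn (c b)))) = along b 1 by rewrite -alongE.
have -> : X (rim_edge (Ordinal lc)) = along b (c b).+1 by rewrite -alongE.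
rewrite /jumps big_ord_recl big_ord_recr /= /bump !add1n along_end addbF !muln1.
rewrite -[RHS]addnA; congr (_ + _); rewrite addnC; congr (_ + _).
apply: eq_bigr => o _; rewrite spoke_used add1n.
by rewrite [node _ _ == _](_ : _ = false) ?muln1 // /node point_ordS.
Qed.

(** The hub has degree 0 or 2, and every fan contributes an even number of jumps
    to it.  A fan without jumps is not used at all; as X is nonempty, exactly
    one fan has jumps, namely two, and they delimit an arc. *)
Lemma base_two_regular_arc :
  exists b i j, i < j < (c b).+2 /\ X =1 arc b i j.
Proof.
have [[e Xe] _] := regX.
have [d Jd] := hub_jumps.
have even b : ~~ odd (jumps (along b) (c b).+2).
  by rewrite odd_jumps along_end.
have Xj b : jumps (along b) (c b).+2 = 0 ->
    (forall l : 'I__, X (@rim_edge b l) = false) /\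
    (forall o : 'I__, X (@spoke_edge b o) = false).
  move=> J0; have al l : l <= (c b).+2 -> along b l = false by apply: jumps0.
  split=> [l|o]; first by rewrite -alongE al // ltnW // ltnS ltn_ord.
  by rewrite spoke_used !al // ?ltnS; have := ltn_ord o; lia.
have [b Jb] : exists b, jumps (along b) (c b).+2 != 0.
  case: e Xe => [q|[[b l]|[b o]]]; first by rewrite leaf_unused.
    by move=> Xl; exists b; apply/eqP => /Xj[/(_ l)]; rewrite /rim_edge Xl.
  by move=> Xo; exists b; apply/eqP => /Xj[_ /(_ o)]; rewrite /spoke_edge Xo.
move: Jd; rewrite (bigD1 b) //= => Jd.
(* The hub allows at most 2 jumps in total, and parity excludes 1 in this fan. *)
have J2 : jumps (along b) (c b).+2 = 2.
  have := even b; move: Jb Jd.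
  by case: jumps => [|[|[|n]]] //; case: (d) => //=; lia.
have Jne b' : b' != b -> jumps (along b') (c b').+2 = 0.
  move: Jd; rewrite J2 => Jd ne; apply/eqP; rewrite -leqn0.
  have : \sum_(b' | b' != b) jumps (along b') (c b').+2 <= 0.
    by case: (d) Jd => /=; lia.
  by rewrite (bigD1 b') //=; lia.
have [//|i [j [ij Hij]]] := jumps2 _ J2.
exists b, i, j; split=> // -[q|[[b' l]|[b' o]]] /=; first by rewrite leaf_unused.
  have [E|/Jne/Xj[/(_ l)//]] := eqVneq b' b; subst b'.
  by rewrite -/(rim_edge l) -alongE; have [] := Hij l (ltnW (ltn_ord l)).
have [E|/Jne/Xj[_ /(_ o)//]] := eqVneq b' b; subst b'.
rewrite -/(spoke_edge o) spoke_used; have [] // := Hij o.+1.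
by rewrite !ltnS ltnW.
Qed.

End Classification.

Section ArcWeight.
Variables rim spk : B -> nat -> nat.

Definition fan_len (e : fan_edge) : nat :=
  match e with
  | inl _ => 1
  | inr (inl r) => rim (tag r) (tagged r)
  | inr (inr o) => spk (tag o) (tagged o).+1
  end.

(** Spokes are numbered from 1, by the rim point that they reach. *)
Definition arc_len b i j :=
  \sum_(i <= l < j) rim b l + ((if 0 < i then spk b i else 0) +
    (if j <= c b then spk b j else 0)).

Lemma sum_arc b i j : i < j < (c b).+2 ->
  \sum_e arc b i j e * fan_len e = arc_len b i j.
Proof.
case/andP=> ij jc; rewrite sum_fan_edge big1 // add0n.
rewrite (bigD1 b) //= [X in _ + X + _]big1 ?addn0 => [|b' ne]; last first.
  by rewrite big1 // => l _; rewrite (negbTE ne).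
rewrite [X in _ + X](bigD1 b) //=.
rewrite [X in _ + (_ + X)]big1 ?addn0 => [|b' ne]; last first.
  by rewrite big1 // => l _; rewrite (negbTE ne).
rewrite eqxx /=; congr (_ + _).
  rewrite -(big_mkord xpredT (fun l => (i <= l < j) * rim b l)).
  rewrite (big_cat_nat (n := i)) //=; last by lia.
  rewrite (big_cat_nat (n := j) _ _ (m := i)) //=; last by lia.
  rewrite big_nat big1 => [|l li]; last by rewrite leqNgt; case/andP: li => _ ->.
  rewrite add0n [X in _ + X]big_nat [X in _ + X]big1 ?addn0 => [|l lj]; last first.
    by rewrite ltnNge; case/andP: lj => ->; rewrite andbF.
  by rewrite !big_nat; apply: eq_bigr => l ->; rewrite mul1n.
rewrite -(big_mkord xpredT (fun l => ((l.+1 == i) || (l.+1 == j)) * spk b l.+1)).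
have pick a : \sum_(0 <= l < c b) (l.+1 == a) * spk b l.+1 =
    if 0 < a <= c b then spk b a else 0.
  case: a => [|a]; first by rewrite big1 // => l _.
  rewrite ltnS /= big_mkord; case: ltnP => ac.
    rewrite (bigD1 (Ordinal ac)) //= eqxx mul1n big1 ?addn0 // => l.
    by rewrite -val_eqE /= eqSS => /negbTE ->.
  by rewrite big1 // => l _; rewrite eqSS ltn_eqF // (leq_trans (ltn_ord l)).
transitivity (\sum_(0 <= l < c b)
    ((l.+1 == i) * spk b l.+1 + (l.+1 == j) * spk b l.+1)).
  apply: eq_bigr => l _; rewrite -mulnDl; congr (_ * _).
  by case: (eqVneq l.+1 i) => [->|//]; rewrite (ltn_eqF ij).
have ic : i <= c b by lia.
by rewrite big_split /= !pick ic andbT (leq_ltn_trans _ ij).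
Qed.

Lemma sum_fan_len :
  \sum_e fan_len e = p +
    \sum_b (\sum_(0 <= l < (c b).+1) rim b l + \sum_(1 <= l < (c b).+1) spk b l).
Proof.
rewrite sum_fan_edge sum1_card card_ord -big_split /=; congr (_ + _).
apply: eq_bigr => b _; rewrite big_mkord; congr (_ + _).
by rewrite big_add1 big_mkord.
Qed.
End ArcWeight.
End Fans.

Arguments node : simpl never.

(** The cyclomatic number of the graph is the sum of the [(c b).+1]: with W edges
    in the fans and p pendant ones, the vertices number
    p + W + 1 - sum of the [(c b).+1].  Rim segments of length at least 2 make the
    graph loopless, including the rim of a fan without spokes. *)
Lemma admissible_of_fans (B : finType) (c : B -> nat) (rim spk : B -> nat -> nat)
    (p m W : nat) :
  W = \sum_b (\sum_(0 <= l < (c b).+1) rim b l +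
            \sum_(1 <= l < (c b).+1) spk b l) ->
  (forall b l, l <= c b -> 1 < rim b l) ->
  (forall b l, 0 < l <= c b -> 0 < spk b l) ->
  (forall b i j, i < j < (c b).+2 -> m %| arc_len c rim spk b i j) ->
  (forall b i j b' i' j', i < j < (c b).+2 -> i' < j' < (c b').+2 ->
     arc_len c rim spk b i j = arc_len c rim spk b' i' j' ->
     [/\ b = b', i = i' & j = j']) ->
  p + W <= g (p + W + 1 - \sum_b (c b).+1) m.
Proof.
move=> WE rim_gt1 spk_gt0 dvd uni.
have := @admissible_of_weights _ _ (@fan_src B c p) (@fan_tgt B c p)
  (fan_len rim spk) m.
rewrite sum_fan_len -WE.
have -> : #|{: fan_vertex c p}| + (p + W) - #|{: fan_edge c p}| =
    p + W + 1 - \sum_b (c b).+1.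
  by rewrite !card_sum card_option card_ord !card_tagged_ord; lia.
have rimE b (l : 'I_(c b).+1) : l <= c b by rewrite -ltnS.
move=> crit; apply: crit.
- case=> [//|[[b l]|[b o]]] /=; first by rewrite ltnW // rim_gt1.
  by rewrite spk_gt0 /=.
- case=> [q|[[b l]|[b o]]] /=; first by [].
    by rewrite rim_gt1 // orbT.
  by rewrite /node point_ordS.
- by move=> X /base_two_regular_arc[b [i [j [ij XE]]]];
    under eq_bigr => e _ do rewrite XE; rewrite sum_arc // dvd.
move=> X Y /base_two_regular_arc[b [i [j [ij XE]]]].
move=> /base_two_regular_arc[b' [i' [j' [ij' YE]]]].
under eq_bigr => e _ do rewrite XE.
under [RHS]eq_bigr => e _ do rewrite YE.
rewrite !sum_arc // => /uni[] // ? ? ? e; rewrite XE YE; congr arc => //.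
Qed.

(** * Lengths for a family of fans *)

Section FanLengths.
(** A family consists of T fans with q spokes each, numbered a = 1, ..., T, and
    its cycle lengths lie above X.  Rim segments and spokes are measured in units
    of m/2, cycles in units of m. *)
Variables q X T : nat.

(** The lengths are forced by those of the cycles.  The value of [cycle_len] on
    arc (i, j) is A_j + B_i with A_j = X + (j - 1)(q + 1) T + a and
    B_i = - i q T.  In a fan with spokes of length A_i + B_i that reach the
    rim at positions A_i - B_i, arc (i, j) has length 2 (A_j + B_i), as wanted
    in the unit m/2.  Inner rim segments thus have length (2 q + 1) T.  The two
    outer ones also make up for the missing spokes at the hub, which gives
    A_1 - B_1 + 2 B_0 and 2 A_(q+1) - (A_q - B_q); for q = 0 they are the same
    segment and its length is 2 (X + a). *)
Definition rim_half a i :=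
  (if i == 0 then X + q * T + a else (2 * q + 1) * T) +
  (if i == q then X + a else 0).

Definition spoke_half a i := X + i * T + a - q.+1 * T.

(** With d = j - i, the value (d - 1)(q + 1) + i is a mixed radix numeral, as
    i <= q.  So the arcs of one fan get distinct multiples of T, and the index
    a <= T of the fan fills the gaps between them. *)
Definition cycle_len a i j := X + ((j - i.+1) * q.+1 + i) * T + a.

Lemma sum_rim_half a i d : i + d <= q ->
  \sum_(i <= l < i + d.+1) rim_half a l + (if i == 0 then (2 * q + 1) * T else 0)
  = d.+1 * ((2 * q + 1) * T) + (if i == 0 then X + q * T + a else 0) +
    (if i + d == q then X + a else 0).
Proof.
elim: d => [|d IH] idq.
  rewrite addn1 big_nat1 /rim_half addn0 mul1n.
  by case: (i == 0); case: (i == q); lia.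
rewrite addnS big_nat_recr /=; last by lia.
have := IH; have -> : (i + d == q) = false by lia.
have -> : i + d <= q by lia.
rewrite /rim_half; have -> : (i + d.+1 == 0) = false by lia.
by rewrite [d.+2 * _]mulSn => /(_ isT); lia.
Qed.

(** The role of q * T <= X is to make the spokes long enough for the subtraction
    in [spoke_half] not to be truncated. *)
Lemma arc_half a i j : q * T <= X -> i < j < q.+2 ->
  \sum_(i <= l < j) rim_half a l + ((if 0 < i then spoke_half a i else 0) +
    (if j <= q then spoke_half a j else 0)) = 2 * cycle_len a i j.
Proof.
move=> qX /andP[ij jq].
have [d jE] : exists d, j = i + d.+1 by exists (j - i.+1); lia.
subst j; have := @sum_rim_half a i d; rewrite /cycle_len.
have -> : i + d.+1 - i.+1 = d by lia.
have -> : i + d <= q by lia.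
move=> /(_ isT); set R := \sum_(_ <= _ < _) _; rewrite /spoke_half.
case: (posnP i) => [->|i0].
  case: (eqVneq (0 + d) q) => [dq|ne] /=.
    have -> : (0 + d.+1 <= q) = false by lia.
    by rewrite -dq in qX *; nia.
  have -> : 0 + d.+1 <= q by lia.
  nia.
have spoke_ok : q.+1 * T <= X + i * T.
  by have : T <= i * T by [rewrite leq_pmull]; lia.
case: (eqVneq (i + d) q) => [dq|ne] /=.
  have -> : (i + d.+1 <= q) = false by lia.
  by rewrite -dq in spoke_ok *; lia.
have -> : i + d.+1 <= q by lia.
lia.
Qed.

Lemma spoke_half_gt0 a i : q * T <= X -> 0 < a -> 0 < i -> 0 < spoke_half a i.
Proof. by rewrite /spoke_half; case: i => // i; nia. Qed.

Lemma rim_half_gt1 a i : 0 < T -> 0 < a -> i <= q -> 1 < rim_half a i.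
Proof. rewrite /rim_half; case: eqP => [->|]; case: eqP; nia. Qed.

Lemma cycle_len_bounds a i j : i < j < q.+2 -> 0 < a <= T ->
  X < cycle_len a i j <= X + (q * q.+1 + 1) * T.
Proof.
rewrite /cycle_len => /andP[ij jq] /andP[a0 aT].
have h : (j - i.+1) * q.+1 + i <= q * q.+1.
  have : j - i.+1 <= q - i by lia.
  by move: (j - i.+1) => d dq; nia.
by move: (_ + i) h => y yq; nia.
Qed.

Lemma euclid_unique d y r y' r' : r < d -> r' < d -> y * d + r = y' * d + r' ->
  y = y' /\ r = r'.
Proof.
move=> rd rd' E; have d0 : 0 < d by lia.
have rr : r = r'.
  by rewrite -(modn_small rd) -(modnMDl y) E modnMDl modn_small.
split=> //; move/eqP: E.
by rewrite rr eqn_add2r eqn_pmul2r // => /eqP.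
Qed.

Lemma cycle_len_inj a i j a' i' j' :
  i < j < q.+2 -> 0 < a <= T -> i' < j' < q.+2 -> 0 < a' <= T ->
  cycle_len a i j = cycle_len a' i' j' -> [/\ a = a', i = i' & j = j'].
Proof.
rewrite /cycle_len => ij aT ij' aT' E.
have [] := @euclid_unique T ((j - i.+1) * q.+1 + i) a.-1
  ((j' - i'.+1) * q.+1 + i') a'.-1; try lia.
move=> yy aa; have [] := @euclid_unique q.+1 (j - i.+1) i (j' - i'.+1) i'; try lia.
by move=> d ii; split; lia.
Qed.

Definition fan_half a :=
  2 * cycle_len a 0 q.+1 + \sum_(1 <= i < q.+1) spoke_half a i.

(** Doubled in order to avoid a division: the spokes of fan a add up to
    q (X + a) - q (q + 1) T / 2. *)
Lemma fan_half_total : q * T <= X ->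
  2 * (\sum_(a < T) fan_half a.+1) =
  (q + 2) * (2 * X * T + T * T + T) + 3 * q * q.+1 * T * T.
Proof.
move=> qX.
have spokes a : 0 < a -> 2 * (\sum_(1 <= i < q.+1) spoke_half a i) + q * q.+1 * T =
    2 * q * (X + a).
  move=> a0; suff /(_ q) : forall r, 2 * (\sum_(1 <= i < r.+1) spoke_half a i) +
      2 * r * (q.+1 * T) = 2 * r * (X + a) + r * r.+1 * T by lia.
  elim=> [|r IH]; first by rewrite big_geq.
  rewrite big_nat_recr //= mulnDr /spoke_half.
  have : q.+1 * T <= X + r.+1 * T by lia.
  by move: IH; set s := \sum_(_ <= _ < _) _; lia.
have : forall t, 2 * (\sum_(a < t) fan_half a.+1) + q * q.+1 * T * t =
    2 * (2 + q) * X * t + (2 + q) * (t * t + t) + 4 * q * q.+1 * T * t.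
  elim=> [|t IH].
    by rewrite big_ord0; lia.
  have fanE : fan_half t.+1 = 2 * (X + q * q.+1 * T + t.+1) +
      \sum_(1 <= i < q.+1) spoke_half t.+1 i.
    by rewrite /fan_half /cycle_len subn1 addn0.
  rewrite big_ord_recr /= fanE; have := spokes t.+1 isT; move: IH.
  by move: (\sum_(_ < t) _) (\sum_(_ <= _ < _) _) => A D; clear; lia.
move/(_ T); lia.
Qed.
End FanLengths.

(** Each family occupies an interval of lengths, so families with disjoint
    intervals can share the hub.  The sum bounded in the last hypothesis is
    twice the total number of edges of the fans, in units of h = m/2. *)
Lemma admissible_of_families (I : finType) (q X T : I -> nat) (h C n : nat) :
  0 < h ->
  (forall u, q u * T u <= X u) ->
  (forall u v, u != v -> X u + (q u * (q u).+1 + 1) * T u <= X v \/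
                         X v + (q v * (q v).+1 + 1) * T v <= X u) ->
  C = \sum_u (q u).+1 * T u ->
  h * (\sum_u ((q u + 2) * (2 * X u * T u + T u * T u + T u)
               + 3 * q u * (q u).+1 * T u * T u)) + 2 <= 2 * (n + C) ->
  n + C - 1 <= g n (h * 2).
Proof.
move=> h0 qX sep CE.
pose W := \sum_u \sum_(l < T u) fan_half (q u) (X u) (T u) l.+1.
rewrite (_ : \sum_u _ = 2 * W); last first.
  by rewrite big_distrr /=; apply: eq_bigr => u _; rewrite fan_half_total.
move=> hn.
pose B := {u : I & 'I_(T u)}.
pose c (b : B) := q (tag b).
pose value (b : B) := cycle_len (q (tag b)) (X (tag b)) (T (tag b)) (tagged b).+1.
pose rim (b : B) i := h * rim_half (q (tag b)) (X (tag b)) (T (tag b)) (tagged b).+1 i.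
pose spk (b : B) i := h * spoke_half (q (tag b)) (X (tag b)) (T (tag b)) (tagged b).+1 i.
have arcE b i j : i < j < (c b).+2 -> arc_len c rim spk b i j = h * 2 * value b i j.
  move=> ij; rewrite -mulnA -(arc_half _ (qX _) ij).
  rewrite mulnDr mulnDr big_distrr /= /arc_len; congr (_ + (_ + _)).
    by case: (0 < i); rewrite ?muln0.
  by rewrite /c; case: (j <= _); rewrite ?muln0.
have CB : \sum_(b : B) (c b).+1 = C.
  rewrite CE; transitivity (\sum_u \sum_(l < T u) (q u).+1).
    by rewrite sig_big_dep /=.
  by apply: eq_bigr => u _; rewrite sum_nat_const card_ord mulnC.
have WB : h * W = \sum_(b : B) (\sum_(0 <= l < (c b).+1) rim b l +
                          \sum_(1 <= l < (c b).+1) spk b l).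
  transitivity (\sum_u \sum_(l < T u) h * fan_half (q u) (X u) (T u) l.+1).
    under eq_bigr => u _ do rewrite -big_distrr.
    by rewrite -big_distrr.
  rewrite sig_big_dep /=; apply: eq_bigr => -[u l] _ /=.
  rewrite /fan_half mulnDr big_distrr /=; congr (_ + _).
  rewrite -(@arc_half (q u) _ _ _ 0 (q u).+1) ?ltnS ?leqnn //.
  by rewrite !ltnn !addn0 big_distrr.
have a_bound (b : B) : 0 < (tagged b).+1 <= T (tag b) by rewrite /= ltn_ord.
have T_gt0 (b : B) : 0 < T (tag b) by apply: leq_trans (a_bound b).
have := @admissible_of_fans B c rim spk (n + C - 1 - h * W) (h * 2) _ WB.
have -> : n + C - 1 - h * W + h * W = n + C - 1 by lia.
have -> : n + C - 1 + 1 - \sum_(b : B) (c b).+1 = n by rewrite CB; lia.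
move=> crit; apply: crit.
- by move=> b l lc; apply: leq_trans (leq_pmull _ h0); apply: rim_half_gt1.
- move=> b l /andP[l0 _]; rewrite muln_gt0 h0; exact: spoke_half_gt0.
- by move=> b i j ij; rewrite arcE // dvdn_mulr.
move=> b i j b' i' j' ij ij'; rewrite !arcE // => /eqP.
rewrite eqn_pmul2l ?muln_gt0 ?h0 // => /eqP E.
have bb := @cycle_len_bounds (q (tag b)) (X (tag b)) _ _ _ _ ij (a_bound b).
have bb' := @cycle_len_bounds (q (tag b')) (X (tag b')) _ _ _ _ ij' (a_bound b').
have tt : tag b = tag b'.
  move: bb bb'; rewrite -[cycle_len _ _ _ _ i' j']E => /andP[lo hi] /andP[lo' hi'].
  apply/eqP/negPn/negP => /sep[le|le].
    by have := leq_ltn_trans (leq_trans hi le) lo'; rewrite ltnn.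
  by have := leq_ltn_trans (leq_trans hi' le) lo; rewrite ltnn.
case: b b' tt ij ij' E {bb bb'} => u l [u' l'] /= uu; subst u'.
move=> ij ij' /cycle_len_inj[] //; rewrite ?ltn_ord //.
by move=> [] /val_inj -> -> ->.
Qed.

(** * The lower bound *)

Import Order.TTheory GRing.Theory Num.Theory.
Local Open Scope ring_scope.

Theorem theorem5 (m k s1 s2 t : nat)
  (hm : (0 < m)%N) (hk : (0 < k)%N) (hs1 : (0 < s1)%N) (hs2 : (0 < s2)%N)
  (ht : (0 < t)%N) (m_even : ~~ odd m) (s12 : (s2 < s1)%N)
  (hsk : (k < s1 + 3 * s2)%N) (n : nat)
  (hn : let M : rat := m%:R in let K : rat := k%:R in
        let S1 : rat := s1%:R in let S2 : rat := s2%:R in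
        let T : rat := t%:R in
        (3 / 4 * M * K ^+ 2 + 1 / 2 * M * K * S1 + 3 / 2 * M * K * S2
         + 1 / 2 * M * S1 ^+ 2 + 3 / 2 * M * S1 * S2 + 9 / 4 * M * S2 ^+ 2
         + M * K + M * S1 + 3 * M * S2 + 1 / 2 * M) * T ^+ 2
        + (1 / 4 * M * K + 1 / 2 * M * S1 + 3 / 4 * M * S2
           - K - S1 - 2 * S2 + 1 / 2 * M - 1) * T + 1 <= n%:R) :
  (n + (k + s1 + 2 * s2 + 1) * t - 1 <= g n m)%N.
Proof.
have [h hE] : exists h, m = (h * 2)%N by exists m./2; rewrite muln2 even_halfK.
subst m; have h0 : (0 < h)%N by move: hm; rewrite muln_gt0 => /andP[].
(* Single cycles, theta graphs and fans with k spokes, in this order of length. *)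
pose q (u : 'I_3) := nth 0%N [:: 0; 1; k]%N u.
pose X (u : 'I_3) := nth 0%N [:: 0; s1 * t; (s1 + 3 * s2) * t]%N u.
pose T (u : 'I_3) := nth 0%N [:: s1 * t; s2 * t; t]%N u.
apply: (@admissible_of_families _ q X T h) => //.
- case=> -[|[|[|//]]] i; rewrite /q /X /T /= ?mul1n //.
    by rewrite leq_mul2r ltnW ?orbT.
  by rewrite leq_mul2r ltnW ?orbT.
- case=> -[|[|[|//]]] i; case=> -[|[|[|//]]] i' // _; rewrite /q /X /T /=;
    clear; lia.
- by rewrite !big_ord_recl big_ord0 /q /T /=; clear; lia.
rewrite !big_ord_recl big_ord0 /q /X /T /=.
(* The remaining inequality is twice [hn]. *)
rewrite -(ler_nat rat) !(natrD, natrM) /=.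
move: hn; rewrite /= !natrM; lra.
Qed.
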